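(* Let $G$ be a finite group and $D(G)$ the quantum double of the Hopf algebra $C(G)$ of complex functions on $G$. Then the category $\mathrm{Rep}(D(G))$ of finite-dimensional representations of the algebra $D(G)$ is the same as (equivalent to) the category $\mathrm{Vect}_G(G)$ of $G$-equivariant vector bundles over $G$.
   Context: $C(G)$ has basis the delta functions $\delta_g$, $g\in G$, with $\delta_g\delta_h=\delta_{g,h}\delta_g$, and $\mathbb{C}[G]$ is the group algebra. As a vector space $D(G)=C(G)\otimes\mathbb{C}[G]$, with multiplication $$(\delta_g\otimes x)(\delta_h\otimes y)=\delta_{gx,xh}\,(\delta_g\otimes xy)$$ (where $\delta_{gx,xh}$ is $1$ if $gx=xh$ and $0$ otherwise) and unit $1_{C(G)}\otimes e=\sum_{g\in G}\delta_g\otimes e$. An object of $\mathrm{Vect}_G(G)$ is a finite-dimensional complex vector space $W$ with a grading $W=\bigoplus_{x\in G}W_x$ and a linear representation of $G$ on $W$ such that $g\cdot W_x=W_{gxg^{-1}}$ for all $g,x\in G$ (equivalently, a functor to finite-dimensional vector spaces from the action groupoid of $G$ acting on itself by conjugation). Morphisms are grading-preserving $G$-equivariant linear maps. *)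

(* Defs.v *)
From HB Require Import structures.
From mathcomp Require Import all_boot all_order all_algebra all_fingroup.
From mathcomp Require Import boolp reals.
From mathcomp Require Export complex.
Set Implicit Arguments.
Unset Strict Implicit.
Unset Printing Implicit Defensive.
Import GRing.Theory.
Local Open Scope ring_scope.

Record category := Category {
  obj :> Type;
  hom : obj -> obj -> Type;
  idc : forall X, hom X X;
  compc : forall X Y Z, hom Y Z -> hom X Y -> hom X Z;
  comp_idl : forall X Y (f : hom X Y), compc (idc Y) f = f;
  comp_idr : forall X Y (f : hom X Y), compc f (idc X) = f;
  compcA : forall X Y Z T (h : hom Z T) (g : hom Y Z) (f : hom X Y),
    compc h (compc g f) = compc (compc h g) f
}.

Arguments hom {c} X Y.
Arguments idc {c} X.
Arguments compc {c X Y Z} g f.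

Record functor (A B : category) := Functor {
  fobj :> A -> B;
  fmap : forall X Y : A, hom X Y -> hom (fobj X) (fobj Y);
  fmap_id : forall X : A, fmap (idc X) = idc (fobj X);
  fmap_comp : forall (X Y Z : A) (g : hom Y Z) (f : hom X Y),
    fmap (compc g f) = compc (fmap g) (fmap f)
}.

Arguments fmap {A B} _ {X Y} _.

Definition functor_id (A : category) : functor A A :=
  @Functor A A (fun X => X) (fun X Y f => f)
    (fun X => erefl) (fun X Y Z g f => erefl).

Section FunctorComp.
Variables (A B C : category) (G : functor B C) (F : functor A B).

Let cmap (X Y : A) (f : hom X Y) : hom (G (F X)) (G (F Y)) := fmap G (fmap F f).

Fact cmap_id X : cmap (idc X) = idc (G (F X)).
Proof. by rewrite /cmap !fmap_id. Qed.

Fact cmap_comp X Y Z (g : hom Y Z) (f : hom X Y) :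
  cmap (compc g f) = compc (cmap g) (cmap f).
Proof. by rewrite /cmap !fmap_comp. Qed.

Definition functor_comp : functor A C := Functor cmap_id cmap_comp.
End FunctorComp.

Record nat_iso (A B : category) (F G : functor A B) := NatIso {
  nat_fwd : forall X : A, hom (F X) (G X);
  nat_bwd : forall X : A, hom (G X) (F X);
  nat_fwdK : forall X, compc (nat_bwd X) (nat_fwd X) = idc (F X);
  nat_bwdK : forall X, compc (nat_fwd X) (nat_bwd X) = idc (G X);
  nat_natural : forall (X Y : A) (f : hom X Y),
    compc (nat_fwd Y) (fmap F f) = compc (fmap G f) (nat_fwd X)
}.

Definition equivalent_categories (A B : category) : Prop :=
  exists (F : functor A B) (G : functor B A),
    inhabited (nat_iso (functor_comp G F) (functor_id A)) /\
    inhabited (nat_iso (functor_comp F G) (functor_id B)).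

(* The ring structure on 'End(V) requires V to be nonzero, so the axioms of an
   algebra morphism A -> 'End(V) are spelled out; V = 0 is allowed. *)
Section Representations.
Variables (F : fieldType) (A : algType F).

Record rep := Rep {
  rep_space :> vectType F;
  rep_act : {linear A -> 'End(rep_space)};
  rep_act1 : rep_act 1 = \1%VF;
  rep_actM : forall a b, rep_act (a * b) = (rep_act a \o rep_act b)%VF
}.

Record rep_hom (V W : rep) := RepHom {
  rep_fun :> 'Hom(V, W);
  rep_funP : forall a, (rep_fun \o rep_act V a)%VF = (rep_act W a \o rep_fun)%VF
}.

Lemma rep_hom_inj V W (f g : rep_hom V W) :
  rep_fun f = rep_fun g -> f = g.
Proof.
case: f g => [f fP] [g gP] /= eq_fg; case: _ / eq_fg gP => gP.
by congr RepHom; apply: Prop_irrelevance.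
Qed.

Fact rep_id_subproof (V : rep) a :
  (\1 \o rep_act V a)%VF = (rep_act V a \o \1)%VF.
Proof. by rewrite comp_lfun1l comp_lfun1r. Qed.

Definition rep_id V : rep_hom V V := RepHom (@rep_id_subproof V).

Fact rep_comp_subproof (U V W : rep) (g : rep_hom V W) (f : rep_hom U V) a :
  ((g \o f) \o rep_act U a)%VF = (rep_act W a \o (g \o f))%VF.
Proof. by rewrite -comp_lfunA rep_funP comp_lfunA rep_funP comp_lfunA. Qed.

Definition rep_comp U V W g f : rep_hom U W :=
  RepHom (@rep_comp_subproof U V W g f).

Definition RepCat : category.
Proof.
refine (@Category rep rep_hom rep_id rep_comp _ _ _) => *; apply: rep_hom_inj.
- exact: comp_lfun1l.
- exact: comp_lfun1r.
- exact: comp_lfunA.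
Defined.

End Representations.

(* C(G) (x) F[G], as the space of functions on G * G: the basis vector
   delta_g (x) x is the indicator function of (g, x).  The alias hides the
   pointwise product of {ffun _ -> _}; F^o is F as a vector space over itself. *)
Definition qdouble (F : fieldType) (gT : finGroupType) : Type :=
  {ffun gT * gT -> F^o}.

HB.instance Definition _ (F : fieldType) (gT : finGroupType) :=
  GRing.Lmodule.copy (qdouble F gT) {ffun gT * gT -> F^o}.

Section QuantumDouble.
Variables (F : fieldType) (gT : finGroupType).
Local Notation D := (qdouble F gT).
Implicit Types (g h x y z : gT) (a b c : D).

Definition qd_basis g x : D := [ffun p => (p == (g, x))%:R].

Definition qd_one : D := \sum_(g : gT) qd_basis g 1%g.

(* Bilinear extension of
   (delta_g (x) x)(delta_h (x) y) = delta_{gx,xh} (delta_g (x) xy). *)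
Definition qd_mul a b : D :=
  \sum_g \sum_x \sum_h \sum_y
    (a (g, x) * b (h, y)) *:
      (((g * x)%g == (x * h)%g)%:R *: qd_basis g (x * y)%g).

Fact qd_oneE g z : qd_one (g, z) = (z == 1%g)%:R.
Proof.
rewrite sum_ffunE (bigD1 g) //= ffunE big1 => [|h /negPf nhg].
  by rewrite addr0 xpair_eqE eqxx.
by rewrite ffunE xpair_eqE eq_sym nhg.
Qed.

Fact qd_mulE a b g z :
  qd_mul a b (g, z) = \sum_x a (g, x) * b (g ^ x, x^-1 * z)%g.
Proof.
rewrite sum_ffunE (bigD1 g) //= [X in _ + X]big1 => [|h nhg].
  rewrite addr0 sum_ffunE; apply: eq_bigr => x _.
  rewrite sum_ffunE (bigD1 (g ^ x)%g) //= [X in _ + X]big1 => [|h nh].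
    rewrite addr0 sum_ffunE (bigD1 (x^-1 * z)%g) //= [X in _ + X]big1 => [|y ny].
      by rewrite !ffunE -conjgC eqxx mulKVg eqxx addr0 scale1r /GRing.scale /= mulr1.
    rewrite !ffunE xpair_eqE eqxx /=.
    have -> : (z == x * y)%g = false.
      by apply: contraNF ny => /eqP ->; rewrite mulKg.
    by rewrite !scaler0.
  rewrite sum_ffunE big1 // => y _.
  have -> : (g * x == x * h)%g = false.
    by apply: contraNF nh => /eqP e; rewrite conjgE e mulKg.
  by rewrite scale0r scaler0 ffunE.
rewrite sum_ffunE big1 // => x _; rewrite sum_ffunE big1 // => k _.
rewrite sum_ffunE big1 // => y _.
by rewrite !ffunE xpair_eqE [g == h]eq_sym (negPf nhg) !scaler0.
Qed.

Fact qd_mulA : associative qd_mul.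
Proof.
move=> a b c; apply/ffunP => -[g z]; rewrite !qd_mulE.
under eq_bigr do rewrite qd_mulE mulr_sumr.
under [RHS]eq_bigr do rewrite qd_mulE mulr_suml.
rewrite [RHS]exchange_big /=; apply: eq_bigr => x _.
rewrite [RHS](reindex_inj (mulgI x)) /=; apply: eq_bigr => y _.
by rewrite mulKg conjgM invMg !mulgA mulrA.
Qed.

Fact qd_mul1 : left_id qd_one qd_mul.
Proof.
move=> a; apply/ffunP => -[g z]; rewrite qd_mulE (bigD1 1%g) //= big1.
  by rewrite qd_oneE eqxx mul1r addr0 conjg1 invg1 mul1g.
by move=> x /negPf nx; rewrite qd_oneE nx mul0r.
Qed.

Fact qd_1mul : right_id qd_one qd_mul.
Proof.
move=> a; apply/ffunP => -[g z]; rewrite qd_mulE (bigD1 z) //= big1.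
  by rewrite qd_oneE mulVg eqxx mulr1 addr0.
move=> x nx; rewrite qd_oneE.
suff -> : (x^-1 * z == 1)%g = false by rewrite mulr0.
by apply: contraNF nx; rewrite -(inj_eq (mulgI x)) mulKVg mulg1 eq_sym.
Qed.

Fact qd_mulDl : left_distributive qd_mul +%R.
Proof.
move=> a b c; apply/ffunP => -[g z]; rewrite ffunE !qd_mulE -big_split /=.
by apply: eq_bigr => x _; rewrite ffunE mulrDl.
Qed.

Fact qd_mulDr : right_distributive qd_mul +%R.
Proof.
move=> a b c; apply/ffunP => -[g z]; rewrite ffunE !qd_mulE -big_split /=.
by apply: eq_bigr => x _; rewrite ffunE mulrDr.
Qed.

Fact qd_one_neq0 : qd_one != 0.
Proof.
apply/eqP => /ffunP /(_ (1%g, 1%g)); rewrite qd_oneE eqxx ffunE.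
by apply/eqP; rewrite oner_eq0.
Qed.

HB.instance Definition _ := GRing.Zmodule_isNzRing.Build D
  qd_mulA qd_mul1 qd_1mul qd_mulDl qd_mulDr qd_one_neq0.

Fact qd_scaleAl (k : F) a b : k *: (a * b) = (k *: a) * b.
Proof.
apply/ffunP => -[g z]; rewrite ffunE !qd_mulE /GRing.scale /= mulr_sumr.
by apply: eq_bigr => x _; rewrite ffunE mulrA.
Qed.

HB.instance Definition _ := GRing.Lmodule_isLalgebra.Build F D qd_scaleAl.

Fact qd_scaleAr (k : F) a b : k *: (a * b) = a * (k *: b).
Proof.
apply/ffunP => -[g z]; rewrite ffunE !qd_mulE /GRing.scale /= mulr_sumr.
by apply: eq_bigr => x _; rewrite ffunE mulrCA.
Qed.

HB.instance Definition _ := GRing.Lalgebra_isAlgebra.Build F D qd_scaleAr.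

Lemma qd_basisM g x h y :
  qd_basis g x * qd_basis h y =
    ((g * x)%g == (x * h)%g)%:R *: qd_basis g (x * y)%g.
Proof.
apply/ffunP => -[k z]; rewrite qd_mulE (bigD1 x) //= big1 ?addr0.
  rewrite !ffunE !xpair_eqE eqxx andbT /GRing.scale /=.
  have [-> | _] /= := eqVneq k g; last by rewrite mul0r mulr0.
  rewrite mul1r -natrM mulnb; congr (_ && _)%:R.
    by rewrite conjgE -(inj_eq (mulgI x)) mulKVg.
  by rewrite -(inj_eq (mulgI x)) mulKVg.
by move=> w /negPf nwx; rewrite ffunE xpair_eqE nwx andbF mul0r.
Qed.

End QuantumDouble.

Section EquivariantBundles.
Variables (F : fieldType) (gT : finGroupType).

Record bundle := Bundle {
  bun_space :> vectType F;
  bun_fiber : gT -> {vspace bun_space};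
  bun_act : gT -> 'End(bun_space);
  bun_direct : directv (\sum_(x : gT) bun_fiber x);
  bun_full : (\sum_(x : gT) bun_fiber x = fullv)%VS;
  bun_act1 : bun_act 1%g = \1%VF;
  bun_actM : forall g h, bun_act (g * h)%g = (bun_act g \o bun_act h)%VF;
  bun_act_fiber : forall g x,
    (bun_act g @: bun_fiber x)%VS = bun_fiber (g * x * g^-1)%g
}.

Record bundle_hom (V W : bundle) := BundleHom {
  bun_fun :> 'Hom(V, W);
  bun_fun_fiber : forall x, (bun_fun @: bun_fiber V x <= bun_fiber W x)%VS;
  bun_fun_act : forall g,
    (bun_fun \o bun_act V g)%VF = (bun_act W g \o bun_fun)%VF
}.

Lemma bundle_hom_inj V W (f g : bundle_hom V W) :
  bun_fun f = bun_fun g -> f = g.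
Proof.
case: f g => [f fP fQ] [g gP gQ] /= eq_fg; case: _ / eq_fg gP gQ => gP gQ.
by congr BundleHom; apply: Prop_irrelevance.
Qed.

Fact bundle_id_fiber (V : bundle) x :
  (\1 @: bun_fiber V x <= bun_fiber V x)%VS.
Proof. by rewrite lim1g. Qed.

Fact bundle_id_act (V : bundle) g :
  (\1 \o bun_act V g)%VF = (bun_act V g \o \1)%VF.
Proof. by rewrite comp_lfun1l comp_lfun1r. Qed.

Definition bundle_id V : bundle_hom V V :=
  BundleHom (@bundle_id_fiber V) (@bundle_id_act V).

Section Comp.
Variables (U V W : bundle) (g : bundle_hom V W) (f : bundle_hom U V).

Fact bundle_comp_fiber x :
  ((g \o f)%VF @: bun_fiber U x <= bun_fiber W x)%VS.
Proof.
by rewrite limg_comp (subv_trans (limgS _ (bun_fun_fiber f x))) ?bun_fun_fiber.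
Qed.

Fact bundle_comp_act k :
  ((g \o f) \o bun_act U k)%VF = (bun_act W k \o (g \o f))%VF.
Proof. by rewrite -comp_lfunA bun_fun_act comp_lfunA bun_fun_act comp_lfunA. Qed.

Definition bundle_comp : bundle_hom U W :=
  BundleHom bundle_comp_fiber bundle_comp_act.
End Comp.

Definition BundleCat : category.
Proof.
refine (@Category bundle bundle_hom bundle_id bundle_comp _ _ _) => *;
  apply: bundle_hom_inj.
- exact: comp_lfun1l.
- exact: comp_lfun1r.
- exact: comp_lfunA.
Defined.

End EquivariantBundles.

(* Main.v *)
(** A representation of D(G) is graded by the images of the orthogonal
    idempotents delta_g (x) e, which sum to the unit, and G acts on it through
    the elements 1 (x) x; the relation
    (1 (x) x)(delta_h (x) e) = (delta_{xhx^-1} (x) e)(1 (x) x) is the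
    equivariance of the grading.  Conversely delta_g (x) x acts on a bundle as
    x followed by the projection onto the fiber over g.  Both constructions keep
    the underlying space and the underlying maps, and they are mutually inverse
    up to the identity of that space. *)
Require Import Defs.
From HB Require Import structures.
From mathcomp Require Import all_boot all_order all_algebra all_fingroup.
From mathcomp Require Import reals complex.
Import GRing.Theory.
Local Open Scope ring_scope.
Set Implicit Arguments.
Unset Strict Implicit.
Unset Printing Implicit Defensive.

(** * Composition of linear maps and finite sums *)

Section CompLfunSum.
Variables (F : fieldType) (aT bT cT : vectType F) (I : finType).

Lemma comp_lfun_suml (f : I -> 'Hom(bT, cT)) (g : 'Hom(aT, bT)) :
  ((\sum_i f i) \o g)%VF = \sum_i (f i \o g)%VF.
Proof.
by apply: (big_morph (fun h => h \o g)%VF) => [f1 f2|];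
  rewrite ?comp_lfunDl ?comp_lfun0l.
Qed.

Lemma comp_lfun_sumr (f : 'Hom(bT, cT)) (g : I -> 'Hom(aT, bT)) :
  (f \o (\sum_i g i))%VF = \sum_i (f \o g i)%VF.
Proof.
by apply: (big_morph (fun h => f \o h)%VF) => [g1 g2|];
  rewrite ?comp_lfunDr ?comp_lfun0r.
Qed.

End CompLfunSum.

(** * Idempotents and group elements inside D(G) *)

Section GroupElements.
Variables (F : fieldType) (gT : finGroupType).
Local Notation basis := (@qd_basis F gT).

Lemma qd_basis_sum (a : qdouble F gT) :
  a = \sum_g \sum_x a (g, x) *: basis g x.
Proof.
rewrite pair_bigA /=; apply/ffunP => p; rewrite sum_ffunE (bigD1 p) //= big1.
  by rewrite -surjective_pairing !ffunE -surjective_pairing eqxx addr0 [RHS]mulr1.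
by move=> q /negPf nq; rewrite !ffunE -surjective_pairing eq_sym nq scaler0.
Qed.

(** The copy 1 (x) x of the group element x in D(G). At the identity of the group it is [qd_one] by
    definition, which later settles the unit laws. *)
Definition qd_elt (x : gT) : qdouble F gT := \sum_g basis g x.

(** The condition g x = x h has the single solution h = g ^ x, so one term of the sum survives. At
    the identity this factors [basis g y] as [basis g 1%g * qd_elt y]. *)
Lemma qd_basis_elt g x y : basis g x * qd_elt y = basis g (x * y)%g.
Proof.
rewrite mulr_sumr (bigD1 (g ^ x)%g) //= big1 => [|h nh].
  by rewrite qd_basisM -conjgC eqxx scale1r addr0.
rewrite qd_basisM (_ : (g * x == x * h)%g = false) ?scale0r //.
by apply: contraNF nh => /eqP e; rewrite conjgE e mulKg.
Qed.

(** The same condition g x = x h, now solved for g, leaves one term. At y = 1 this moves a group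
    element past an idempotent, the source of equivariance. *)
Lemma qd_elt_basis x h y :
  qd_elt x * basis h y = basis (x * h * x^-1)%g (x * y)%g.
Proof.
rewrite mulr_suml (bigD1 (x * h * x^-1)%g) //= big1 => [|g ng].
  by rewrite qd_basisM mulgKV eqxx scale1r addr0.
rewrite qd_basisM (_ : (g * x == x * h)%g = false) ?scale0r //.
by apply: contraNF ng => /eqP <-; rewrite mulgK.
Qed.

Lemma qd_eltM x y : qd_elt (x * y)%g = qd_elt x * qd_elt y.
Proof. by rewrite [RHS]mulr_suml; apply: eq_bigr => g _; rewrite qd_basis_elt. Qed.

Lemma qd_basis1M g h : basis g 1%g * basis h 1%g = (g == h)%:R *: basis g 1%g.
Proof. by rewrite qd_basisM !mulg1 mul1g. Qed.

End GroupElements.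

(** * From representations to bundles *)

Section BundleOfRep.
Variables (F : fieldType) (gT : finGroupType).
Implicit Types V W : rep (qdouble F gT).
Local Notation idem V g := (rep_act V (qd_basis F g 1%g)).
Local Notation elt V x := (rep_act V (qd_elt F x)).

Lemma idemK V g h v : idem V g (idem V h v) = (g == h)%:R *: idem V g v.
Proof. by rewrite -comp_lfunE -rep_actM qd_basis1M linearZ scale_lfunE. Qed.

Lemma sum_idem V v : \sum_g idem V g v = v.
Proof. by rewrite -sum_lfunE -linear_sum rep_act1 id_lfunE. Qed.

Fact rep_direct V : directv (\sum_(x : gT) limg (idem V x)).
Proof.
apply/directv_sum_independent => us us_im us0 g _.
have /memv_imgP [v _ usg] := us_im g isT.
(* Orthogonality: applying the idempotent of g to a vanishing sum isolates its component at g. *)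
have: idem V g (\sum_h us h) = us g.
  rewrite linear_sum (bigD1 g) //= big1 ?addr0 => [|h ngh].
    by rewrite usg idemK eqxx scale1r.
  have /memv_imgP [w _ ->] := us_im h isT.
  by rewrite idemK eq_sym (negPf ngh) scale0r.
by rewrite us0 linear0.
Qed.

Fact rep_full V : (\sum_(x : gT) limg (idem V x) = fullv)%VS.
Proof.
apply/eqP; rewrite eqEsubv subvf; apply/subvP => v _; rewrite -[v]sum_idem.
by apply: memv_sumr => g _; rewrite memv_img ?memvf.
Qed.

Fact rep_elt1 V : elt V 1%g = \1%VF.
Proof. exact: rep_act1. Qed.

Fact rep_eltM V g h : elt V (g * h)%g = (elt V g \o elt V h)%VF.
Proof. by rewrite qd_eltM rep_actM. Qed.

(** [elt V g] has the right inverse [elt V g^-1], hence is onto. *)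
Lemma limg_elt V g : limg (elt V g) = fullv.
Proof.
apply/eqP; rewrite eqEsubv subvf -[X in (X <= _)%VS]lim1g -rep_elt1 -(mulgV g).
by rewrite rep_eltM limg_comp limgS ?subvf.
Qed.

Fact rep_elt_fiber V g x :
  (elt V g @: limg (idem V x))%VS = limg (idem V (g * x * g^-1)%g).
Proof.
(* The product is rewritten as the idempotent at g x g^-1 applied after [elt V g], which is onto and
   so drops out of the image. *)
rewrite -limg_comp -rep_actM qd_elt_basis mulg1 -[X in qd_basis _ _ X]mul1g.
by rewrite -qd_basis_elt rep_actM limg_comp limg_elt.
Qed.

Definition bundle_of_rep V : bundle F gT :=
  Bundle (rep_direct V) (rep_full V) (rep_elt1 V) (rep_eltM V)
    (rep_elt_fiber V).

Fact rep_hom_fiber V W (f : rep_hom V W) x :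
  (f @: bun_fiber (bundle_of_rep V) x <= bun_fiber (bundle_of_rep W) x)%VS.
Proof. by rewrite /= -limg_comp rep_funP limg_comp limgS ?subvf. Qed.

Definition bundle_hom_of_rep V W (f : rep_hom V W) :
    bundle_hom (bundle_of_rep V) (bundle_of_rep W) :=
  @BundleHom F gT (bundle_of_rep V) (bundle_of_rep W) f (rep_hom_fiber f)
    (fun g => rep_funP f (qd_elt F g)).

Definition bundle_functor : functor (RepCat (qdouble F gT)) (BundleCat F gT).
Proof.
refine (@Functor (RepCat (qdouble F gT)) (BundleCat F gT)
          bundle_of_rep bundle_hom_of_rep _ _) => *; exact: bundle_hom_inj.
Defined.

End BundleOfRep.

(** * Projections onto the fibers of a bundle *)

Section FiberProjection.
Variables (F : fieldType) (gT : finGroupType).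
Implicit Types V W : bundle F gT.

(** [sumv_pi_for] splits vectors along any sum of subspaces; directness, used in [bun_proj_sum],
    makes the splitting canonical. *)
Definition bun_proj V g : 'End(bun_space V) :=
  sumv_pi_for (esym (bun_full V)) g.

Lemma mem_bun_proj V g v : bun_proj V g v \in bun_fiber V g.
Proof. exact: memv_sum_pi. Qed.

Lemma sum_bun_proj V v : \sum_g bun_proj V g v = v.
Proof. by apply: sumv_pi_sum; rewrite memvf. Qed.

Lemma bun_proj_sum V (u : gT -> V) g :
  (forall h, u h \in bun_fiber V h) -> bun_proj V g (\sum_h u h) = u g.
Proof.
move=> u_fib; set v := \sum_h u h; have dV := bun_direct V.
have /eqP := sum_bun_proj v.
rewrite (directv_sum_unique dV _ _ (fun h _ => mem_bun_proj h v) (fun h _ => u_fib h)).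
by move/forall_inP/(_ g isT)/eqP.
Qed.

Lemma bun_proj_fiber V g h v :
  v \in bun_fiber V h -> bun_proj V g v = (g == h)%:R *: v.
Proof.
move=> v_h; rewrite -(@bun_proj_sum V (fun k => (k == h)%:R *: v) g).
  rewrite (bigD1 h) //= big1 ?addr0 ?eqxx ?scale1r // => k /negPf ->.
  by rewrite scale0r.
by move=> k; have [->|_] := eqVneq k h; rewrite ?scale1r // scale0r mem0v.
Qed.

Lemma limg_bun_proj V g : limg (bun_proj V g) = bun_fiber V g.
Proof.
apply/eqP; rewrite eqEsubv; apply/andP; split; apply/subvP => v.
  by case/memv_imgP => w _ ->; apply: mem_bun_proj.
move=> vg; have <- : bun_proj V g v = v.
  by rewrite (bun_proj_fiber _ vg) eqxx scale1r.
by rewrite memv_img ?memvf.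
Qed.

(** The action of x carries the fiber over g ^ x to the fiber over g, so it sends the decomposition
    of v to that of its image, reindexed by conjugation. *)
Lemma bun_act_proj V x g v :
  bun_proj V g (bun_act V x v) = bun_act V x (bun_proj V (g ^ x)%g v).
Proof.
rewrite -{1}[v]sum_bun_proj linear_sum (reindex_inj (conjg_inj x)) /=.
apply: (bun_proj_sum (u := fun h => bun_act V x (bun_proj V (h ^ x)%g v))) => h.
have -> : h = (x * (h ^ x) * x^-1)%g by rewrite -conjgC mulgK.
by rewrite -bun_act_fiber memv_img // -conjgC mulgK mem_bun_proj.
Qed.

(** f carries the decomposition of v to a decomposition of f v, and the latter is unique. *)
Lemma bun_hom_proj V W (f : bundle_hom V W) g v :
  f (bun_proj V g v) = bun_proj W g (f v).
Proof.
rewrite -{2}[v]sum_bun_proj linear_sum bun_proj_sum // => h.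
by apply: subvP (bun_fun_fiber f h) _ _; rewrite memv_img ?mem_bun_proj.
Qed.

End FiberProjection.

(** * From bundles to representations *)

Section RepOfBundle.
Variables (F : fieldType) (gT : finGroupType).
Implicit Types V W : bundle F gT.

Definition qd_act V (a : qdouble F gT) : 'End(bun_space V) :=
  \sum_g \sum_x a (g, x) *: (bun_proj V g \o bun_act V x)%VF.

Fact qd_act_linear V : linear (qd_act V).
Proof.
move=> k a b; rewrite /qd_act scaler_sumr -big_split; apply: eq_bigr => g _.
rewrite scaler_sumr -big_split; apply: eq_bigr => x _.
by rewrite !ffunE scalerDl scalerA.
Qed.

HB.instance Definition _ V :=
  GRing.isLinear.Build F (qdouble F gT) 'End(bun_space V) *:%R (qd_act V)
    (qd_act_linear V).

Lemma qd_act_basis V g x :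
  qd_act V (qd_basis F g x) = (bun_proj V g \o bun_act V x)%VF.
Proof.
rewrite /qd_act pair_bigA (bigD1 (g, x)) //= big1 => [|p /negPf np].
  by rewrite ffunE eqxx scale1r addr0.
by rewrite ffunE -surjective_pairing np scale0r.
Qed.

Lemma qd_act_elt V x : qd_act V (qd_elt F x) = bun_act V x.
Proof.
apply/lfunP => v; rewrite /qd_elt linear_sum sum_lfunE /=.
under eq_bigr do rewrite qd_act_basis comp_lfunE.
exact: sum_bun_proj.
Qed.

Fact qd_act1 V : qd_act V 1 = \1%VF.
Proof. by rewrite -(bun_act1 V) -qd_act_elt. Qed.

(** Moved past the action of x, the projection at g becomes the one at g ^ x and meets the
    projection at h. The composite vanishes unless g ^ x = h, that is g x = x h, the condition in
    the product of D(G). *)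
Lemma qd_act_basisM V g x h y :
  qd_act V (qd_basis F g x * qd_basis F h y) =
    (qd_act V (qd_basis F g x) \o qd_act V (qd_basis F h y))%VF.
Proof.
rewrite qd_basisM linearZ /= !qd_act_basis; apply/lfunP => v.
rewrite scale_lfunE !comp_lfunE /= bun_act_proj.
rewrite (bun_proj_fiber _ (mem_bun_proj _ _)) linearZ /=.
rewrite [(g ^ x == h)%g](_ : _ = (g * x == x * h)%g); last first.
  by rewrite conjgC (inj_eq (mulgI x)).
have [e|_] := eqVneq (g * x)%g (x * h)%g; last by rewrite !scale0r.
by rewrite !scale1r bun_actM comp_lfunE !bun_act_proj (conjgE g) e mulKg.
Qed.

Fact qd_actM V a b : qd_act V (a * b) = (qd_act V a \o qd_act V b)%VF.
Proof.
rewrite [a]qd_basis_sum [b]qd_basis_sum !pair_bigA /= mulr_suml !linear_sum /=.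
rewrite comp_lfun_suml; apply: eq_bigr => p _.
rewrite mulr_sumr linear_sum comp_lfun_sumr; apply: eq_bigr => q _.
rewrite -scalerAl -scalerAr !linearZ /= qd_act_basisM.
by rewrite -comp_lfunZl -comp_lfunZr.
Qed.

Definition rep_of_bundle V : rep (qdouble F gT) :=
  @Rep F (qdouble F gT) (bun_space V) (qd_act V) (qd_act1 V) (@qd_actM V).

Fact bundle_hom_rep V W (f : bundle_hom V W) a :
  (f \o rep_act (rep_of_bundle V) a)%VF
    = (rep_act (rep_of_bundle W) a \o f)%VF.
Proof.
rewrite /= /qd_act comp_lfun_sumr comp_lfun_suml; apply: eq_bigr => g _.
rewrite comp_lfun_sumr comp_lfun_suml; apply: eq_bigr => x _.
rewrite -comp_lfunZl -comp_lfunZr -comp_lfunA -bun_fun_act; congr (_ *: _).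
by apply/lfunP => v; rewrite !comp_lfunE bun_hom_proj.
Qed.

Definition rep_hom_of_bundle V W (f : bundle_hom V W) :
    rep_hom (rep_of_bundle V) (rep_of_bundle W) :=
  @RepHom F _ (rep_of_bundle V) (rep_of_bundle W) f (bundle_hom_rep f).

Definition rep_functor : functor (BundleCat F gT) (RepCat (qdouble F gT)).
Proof.
refine (@Functor (BundleCat F gT) (RepCat (qdouble F gT))
          rep_of_bundle rep_hom_of_bundle _ _) => *; exact: rep_hom_inj.
Defined.

End RepOfBundle.

(** * The two functors are mutually inverse *)

Section Equivalence.
Variables (F : fieldType) (gT : finGroupType).

Lemma rep_of_bundleK (V : rep (qdouble F gT)) a :
  rep_act (rep_of_bundle (bundle_of_rep V)) a = rep_act V a.
Proof.
rewrite [in RHS](qd_basis_sum a) /= /qd_act linear_sum; apply: eq_bigr => g _.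
rewrite linear_sum; apply: eq_bigr => x _; rewrite linearZ; congr (_ *: _).
(* Splitting off the group element leaves the fiber projection to be compared with the action of the
   idempotent; [sum_idem] supplies the decomposition of v that identifies them. *)
rewrite -[x in RHS]mul1g -qd_basis_elt rep_actM; congr (_ \o _)%VF.
apply/lfunP => v; rewrite -{1}[v]sum_idem.
apply: (@bun_proj_sum F gT (bundle_of_rep V)
          (fun h => rep_act V (qd_basis F h 1%g) v)) => h.
by rewrite memv_img ?memvf.
Qed.

Lemma bundle_of_repK_act (V : bundle F gT) x :
  bun_act (bundle_of_rep (rep_of_bundle V)) x = bun_act V x.
Proof. exact: (qd_act_elt V x). Qed.

Lemma bundle_of_repK_fiber (V : bundle F gT) x :
  bun_fiber (bundle_of_rep (rep_of_bundle V)) x = bun_fiber V x.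
Proof. by rewrite /= qd_act_basis bun_act1 comp_lfun1r limg_bun_proj. Qed.

Section RepUnit.
Variable V : rep (qdouble F gT).
Let V' : rep (qdouble F gT) := rep_of_bundle (bundle_of_rep V).

Fact rep_unit_subproof a : (\1 \o rep_act V' a)%VF = (rep_act V a \o \1)%VF.
Proof. by rewrite rep_of_bundleK comp_lfun1l comp_lfun1r. Qed.

Fact rep_unitV_subproof a : (\1 \o rep_act V a)%VF = (rep_act V' a \o \1)%VF.
Proof. by rewrite rep_of_bundleK comp_lfun1l comp_lfun1r. Qed.

(** [V'] and [V] share their space, but their actions agree only by the proved equality
    [rep_of_bundleK], so the identity map is packaged as a morphism each way. *)
Definition rep_unit : rep_hom V' V := @RepHom F _ V' V \1%VF rep_unit_subproof.

Definition rep_unitV : rep_hom V V' := @RepHom F _ V V' \1%VF rep_unitV_subproof.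

End RepUnit.

Definition rep_unit_iso :
  nat_iso (functor_comp (rep_functor F gT) (bundle_functor F gT))
    (functor_id (RepCat (qdouble F gT))).
Proof.
refine (@NatIso _ _
  (functor_comp (rep_functor F gT) (bundle_functor F gT))
  (functor_id (RepCat (qdouble F gT))) rep_unit rep_unitV _ _ _).
- by move=> V; apply: rep_hom_inj; apply: comp_lfun1l.
- by move=> V; apply: rep_hom_inj; apply: comp_lfun1l.
- move=> V W f; apply: rep_hom_inj.
  (* Both functors keep the underlying map, so naturality is 1 f = f 1. *)
  exact: etrans (comp_lfun1l _) (esym (comp_lfun1r _)).
Defined.

Section BundleCounit.
Variable V : bundle F gT.
Let V' : bundle F gT := bundle_of_rep (rep_of_bundle V).

Fact bundle_counit_fiber x : (\1 @: bun_fiber V' x <= bun_fiber V x)%VS.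
Proof. by rewrite lim1g bundle_of_repK_fiber. Qed.

Fact bundle_counit_act x : (\1 \o bun_act V' x)%VF = (bun_act V x \o \1)%VF.
Proof. by rewrite bundle_of_repK_act comp_lfun1l comp_lfun1r. Qed.

Fact bundle_counitV_fiber x : (\1 @: bun_fiber V x <= bun_fiber V' x)%VS.
Proof. by rewrite lim1g bundle_of_repK_fiber. Qed.

Fact bundle_counitV_act x : (\1 \o bun_act V x)%VF = (bun_act V' x \o \1)%VF.
Proof. by rewrite bundle_of_repK_act comp_lfun1l comp_lfun1r. Qed.

Definition bundle_counit : bundle_hom V' V :=
  @BundleHom F gT V' V \1%VF bundle_counit_fiber bundle_counit_act.

Definition bundle_counitV : bundle_hom V V' :=
  @BundleHom F gT V V' \1%VF bundle_counitV_fiber bundle_counitV_act.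

End BundleCounit.

Definition bundle_counit_iso :
  nat_iso (functor_comp (bundle_functor F gT) (rep_functor F gT))
    (functor_id (BundleCat F gT)).
Proof.
refine (@NatIso _ _
  (functor_comp (bundle_functor F gT) (rep_functor F gT))
  (functor_id (BundleCat F gT)) bundle_counit bundle_counitV _ _ _).
- by move=> V; apply: bundle_hom_inj; apply: comp_lfun1l.
- by move=> V; apply: bundle_hom_inj; apply: comp_lfun1l.
- move=> V W f; apply: bundle_hom_inj.
  exact: etrans (comp_lfun1l _) (esym (comp_lfun1r _)).
Defined.

Lemma rep_bundle_equivalent :
  equivalent_categories (RepCat (qdouble F gT)) (BundleCat F gT).
Proof.
exists (bundle_functor F gT), (rep_functor F gT).
by split; split; [apply: rep_unit_iso | apply: bundle_counit_iso].
Qed.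

End Equivalence.

Theorem mainTheorem5 (R : realType) (gT : finGroupType) :
  equivalent_categories (RepCat (qdouble R[i] gT)) (BundleCat R[i] gT).
Proof. exact: rep_bundle_equivalent. Qed.
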